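(* Let $x,\nu$ be complex parameters and let $S=(S_n)_{n\geq1}$ and $T=(T_n)_{n\geq1}$ be complex sequences related by the inversion formulae $S=B(x,\nu)\cdot T\Leftrightarrow T=A(x,\nu)\cdot S$, with the matrices $A(x,\nu)$, $B(x,\nu)$ defined in the context. Then the exponential generating function $\mathfrak{G}_S^*(z)=\sum_{n\geq1}S_n\frac{z^n}{n!}$ of the sequence $S$ can be expressed by $$\mathfrak{G}_S^*(z)=\exp(z)\cdot\sum_{k\geq1}(-1)^kT_k\,\frac{z^k}{k!}\,\Phi(k\nu;k;-x\,z),\qquad z\in\mathbb{C},$$ where $\Phi(\alpha;\beta;\cdot)$ denotes the Confluent Hypergeometric function with parameters $\alpha$, $\beta\notin-\mathbb{N}$.
   Context: $A(x,\nu)$ and $B(x,\nu)$ are the infinite lower-triangular matrices (inverse of each other) with entries, for $1\le k\le n$, $$A_{n,k}(x,\nu)=(-1)^k\binom{n}{k}F(k-n,-n\nu;-n;x),\qquad B_{n,k}(x,\nu)=(-1)^k\binom{n}{k}F(k-n,k\nu;k;x),$$ where $F$ is the Gauss Hypergeometric function, here a polynomial: $F(k-n,\beta;\gamma;x)=\sum_{m=0}^{n-k}\frac{(k-n)_m(\beta)_m}{(\gamma)_m\,m!}x^m$, with Pochhammer symbol $(c)_m=c(c+1)\cdots(c+m-1)$, $(c)_0=1$. The relation $S=B(x,\nu)\cdot T$ means $S_n=\sum_{k=1}^nB_{n,k}(x,\nu)T_k$ for all $n\geq1$, and similarly for $T=A(x,\nu)\cdot S$. The Confluent Hypergeometric function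 is $\Phi(\alpha;\beta;z)=\sum_{m\ge0}\frac{(\alpha)_m}{(\beta)_m}\frac{z^m}{m!}$. *)

(* Defs.v *)
From Stdlib Require Import Reals Factorial.
From Coquelicot Require Import Coquelicot.

Local Open Scope C_scope.

Definition natC (n : nat) : C := RtoC (INR n).

Definition factC (n : nat) : C := natC (fact n).

(* [Binomial.C] is the real-valued binomial coefficient, not the type [C]. *)
Definition binC (n k : nat) : C := RtoC (Binomial.C n k).

Fixpoint pochhammer (c : C) (m : nat) : C :=
  match m with
  | O => 1
  | S p => pochhammer c p * (c + natC p)
  end.

(* The terminating series F(-N, b; c; x). For c = -M with N < M, as in [matA],
   no denominator vanishes up to order N. *)
Definition hypF (N : nat) (b c x : C) : C :=
  sum_n (fun m => pochhammer (- natC N) m * pochhammer b m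
                  / (pochhammer c m * factC m) * x ^ m) N.

(* The truncated difference [n - k] is only meant for 1 <= k <= n. *)
Definition matA (x nu : C) (n k : nat) : C :=
  (-1) ^ k * binC n k * hypF (n - k) (- natC n * nu) (- natC n) x.

Definition matB (x nu : C) (n k : nat) : C :=
  (-1) ^ k * binC n k * hypF (n - k) (natC k * nu) (natC k) x.

(* Sequences are indexed from 1: the value at 0 is never used. *)
Definition is_image (M : nat -> nat -> C) (u v : nat -> C) : Prop :=
  forall n, (1 <= n)%nat -> v n = sum_n_m (fun k => M n k * u k) 1 n.

(* Coquelicot's [Series] is real-valued. This is the sum of the series as soon
   as it converges in C. *)
Definition CSeries (a : nat -> C) : C :=
  (Series (fun n => Re (a n)), Series (fun n => Im (a n))).

Definition Cexp (z : C) : C := CSeries (fun n => z ^ n / factC n).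

Definition Phi_coef (a b : C) (m : nat) : C :=
  pochhammer a m / (pochhammer b m * factC m).

Definition Phi (a b z : C) : C := CSeries (fun m => Phi_coef a b m * z ^ m).

(* Terms of the two series over n >= 1 and k >= 1; for summation from 0 the
   index is shifted in [egf] and in the theorem. *)
Definition egf_term (s : nat -> C) (z : C) (n : nat) : C :=
  s n * (z ^ n / factC n).

Definition Phi_term (x nu : C) (t : nat -> C) (z : C) (k : nat) : C :=
  (-1) ^ k * t k * (z ^ k / factC k) * Phi (natC k * nu) (natC k) (- x * z).

Definition egf (s : nat -> C) (z : C) : C :=
  CSeries (fun n => egf_term s z (S n)).

(* Formal power series in z, given by their coefficients. *)
Definition fps := nat -> C.

Definition fps_mul (f g : fps) : fps :=
  fun n => sum_n (fun i => f i * g (n - i)%nat) n.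

Definition fps_scale (c : C) (f : fps) : fps := fun n => c * f n.

Definition fps_mulXn (k : nat) (f : fps) : fps :=
  fun n => if Nat.ltb n k then 0 else f (n - k)%nat.

(* Sum over k >= 1 of a family in which f k is divisible by z^k. *)
Definition fps_sum (f : nat -> fps) : fps :=
  fun n => sum_n_m (fun k => f k n) 1 n.

Definition fps_exp : fps := fun n => / factC n.

(* The series of Phi(a; b; w z). *)
Definition fps_Phi (a b w : C) : fps := fun m => Phi_coef a b m * w ^ m.

Definition fps_egf (s : nat -> C) : fps :=
  fun n => if Nat.eqb n 0 then 0 else s n / factC n.

(* Main.v *)
Require Import Defs.
From Stdlib Require Import Reals Factorial Lra Lia Wf_nat.
From Coquelicot Require Import Coquelicot.

(** With [a n = s n / n!] and [b n = (-1)^n t n / n!], the relation [s = B t]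
    reads [a = E P b], where [E] has entries [1 / (n - k)!] and [P] has the Taylor
    coefficients of [Phi (k nu) k (- x z)] in its [k]-th column. This is the formal
    identity. Similarly [t = A s] reads [b = Q E^-1 a], where [P Q = 1] because
    each entry off the diagonal is a multiple of a finite difference of order [d]
    of a polynomial of degree [d - 1].

    At a fixed [z], all these kernels, scaled by [z ^ (n - k)], are bounded by
    [rho ^ (n - k) / (n - k)!], so they preserve null sequences, and on null
    sequences the partial sums of the image and those obtained by summing each
    column first have the same limit. If the left series converges, [a n z ^ n]
    is null, hence so is [b n z ^ n]. If the right series converges,
    [b n z ^ n] is null because [Phi (k nu) k (- x z)] tends to
    [exp (- nu x z)], which is not zero. *)

Local Open Scope C_scope.
Set Bullet Behavior "Strict Subproofs".

(* Coquelicot's sums put equalities at a canonical structure projection, which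
   [ring] and [field] do not recognize as [C]. *)
Ltac at_C := match goal with |- @eq _ ?a ?b => change (@eq C a b) end.
Ltac cring := at_C; ring.
Ltac cfield := at_C; field.

(** * Constants and finite sums *)

Lemma natC_S (n : nat) : natC (S n) = natC n + 1.
Proof. unfold natC. rewrite S_INR, RtoC_plus. reflexivity. Qed.

Lemma natC_add (m n : nat) : natC (m + n) = natC m + natC n.
Proof. unfold natC. rewrite plus_INR, RtoC_plus. reflexivity. Qed.

Lemma natC_S_neq0 (n : nat) : natC (S n) <> 0.
Proof. intros H. apply RtoC_inj in H. revert H. apply not_0_INR. discriminate. Qed.

Lemma Cmod_natC (n : nat) : Cmod (natC n) = INR n.
Proof. unfold natC. rewrite Cmod_R. apply Rabs_pos_eq, pos_INR. Qed.

Lemma factC_neq0 (n : nat) : factC n <> 0.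
Proof. intros H. apply RtoC_inj in H. revert H. apply INR_fact_neq_0. Qed.

Lemma factC_S (n : nat) : factC (S n) = natC (S n) * factC n.
Proof.
  unfold factC, natC. rewrite fact_simpl, mult_INR, RtoC_mult. reflexivity.
Qed.

Lemma csum_S (a : nat -> C) (n : nat) : sum_n a (S n) = sum_n a n + a (S n).
Proof. exact (sum_Sn a n). Qed.

Lemma csum_plus (a b : nat -> C) (n : nat) :
  sum_n (fun k => a k + b k) n = sum_n a n + sum_n b n.
Proof. exact (sum_n_plus a b n). Qed.

Lemma csum_mult_l (c : C) (a : nat -> C) (n : nat) :
  sum_n (fun k => c * a k) n = c * sum_n a n.
Proof. exact (sum_n_mult_l c a n). Qed.

Lemma csum_mult_r (c : C) (a : nat -> C) (n : nat) :
  sum_n (fun k => a k * c) n = sum_n a n * c.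
Proof. exact (sum_n_mult_r c a n). Qed.

Lemma csum_minus (a b : nat -> C) (n : nat) :
  sum_n (fun k => a k - b k) n = sum_n a n - sum_n b n.
Proof.
  induction n as [|n IH].
  - rewrite !sum_O. reflexivity.
  - rewrite !csum_S, IH. cring.
Qed.

Lemma csum_S_l (a : nat -> C) (n : nat) :
  sum_n a (S n) = a 0%nat + sum_n (fun k => a (S k)) n.
Proof.
  unfold sum_n. rewrite sum_Sn_m by lia. rewrite sum_n_m_S. reflexivity.
Qed.

Lemma sum_n_rev {G : AbelianMonoid} (a : nat -> G) (n : nat) :
  sum_n a n = sum_n (fun k => a (n - k)%nat) n.
Proof.
  induction n as [|n IH].
  - rewrite !sum_O. reflexivity.
  - rewrite sum_Sn, IH, plus_comm. unfold sum_n at 2.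
    rewrite sum_Sn_m by lia. rewrite <- sum_n_m_S. reflexivity.
Qed.

Lemma csum_m_1 (a : nat -> C) (n : nat) :
  sum_n_m a 1 (S n) = sum_n (fun k => a (S k)) n.
Proof. symmetry. exact (sum_n_m_S a 0 n). Qed.

(** Exchange of rows [l] and columns [k], with [j = l - k]. In the induction, a new row adds one
    entry to every earlier column and opens one new column. *)
Lemma csum_triangle (F : nat -> nat -> C) (n : nat) :
  sum_n (fun l => sum_n (fun k => F l k) l) n =
  sum_n (fun k => sum_n (fun j => F (k + j)%nat k) (n - k)) n.
Proof.
  induction n as [|n IH].
  - rewrite !sum_O. reflexivity.
  - rewrite csum_S, IH, !csum_S, Nat.sub_diag, sum_O, Nat.add_0_r, Cplus_assoc.
    f_equal. rewrite <- csum_plus. apply sum_n_ext_loc. intros k Hk.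
    rewrite (Nat.sub_succ_l k n Hk), csum_S.
    do 2 f_equal. lia.
Qed.

(** Entry of the identity matrix at distance [d] from the diagonal. *)
Definition delta0 (d : nat) : C := if Nat.eqb d 0 then 1 else 0.

Lemma csum_delta (a : nat -> C) (n : nat) :
  sum_n (fun k => a k * delta0 (n - k)) n = a n.
Proof.
  unfold delta0. destruct n as [|n].
  - rewrite sum_O. simpl. cring.
  - rewrite csum_S, Nat.sub_diag.
    rewrite (sum_n_ext_loc _ (fun k => 0 * a k)).
    + rewrite csum_mult_l. simpl. cring.
    + intros k Hk. replace (Nat.eqb (S n - k) 0) with false. cring.
      symmetry. apply Nat.eqb_neq. lia.
Qed.

(** * The inverse pair of matrices *)

(* Finite differences: the signed weights annihilate polynomials of degree
   less than [d]. Multiplication by [l] lowers [d] to [d - 1] and shifts [l]. *)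
Definition diff_weight (d l : nat) : C :=
  (-1) ^ (d - l) / (factC l * factC (d - l)).

(** The factor [l] kills the term [l = 0] and otherwise cancels against [l!], leaving the weights of
    order [d] at [l - 1]. *)
Lemma diff_weight_mul_index (d : nat) (f : nat -> C) :
  sum_n (fun l => diff_weight (S d) l * (natC l * f l)) (S d) =
  sum_n (fun l => diff_weight d l * f (S l)) d.
Proof.
  rewrite csum_S_l. unfold natC at 1. simpl INR.
  rewrite Cmult_0_l, Cmult_0_r, Cplus_0_l.
  apply sum_n_ext. intros l. unfold diff_weight. rewrite factC_S. simpl Nat.sub.
  cfield. repeat split; auto using factC_neq0, natC_S_neq0.
Qed.

(** Here the factor cancels against [(d + 1 - l)!]. The exponent of the sign drops by one, whence
    the minus. *)
Lemma diff_weight_mul_coindex (d : nat) :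
  sum_n (fun l => diff_weight (S d) l * natC (S d - l)) (S d) =
  - sum_n (diff_weight d) d.
Proof.
  rewrite csum_S, Nat.sub_diag. unfold natC at 2. simpl INR.
  rewrite Cmult_0_r, Cplus_0_r.
  replace (- sum_n (diff_weight d) d) with ((-1) * sum_n (diff_weight d) d) by cring.
  rewrite <- csum_mult_l.
  apply sum_n_ext_loc. intros l Hl. unfold diff_weight.
  rewrite (Nat.sub_succ_l l d Hl), factC_S, Cpow_S.
  cfield. repeat split; auto using factC_neq0, natC_S_neq0.
Qed.

(** This is [(1 - 1) ^ (d + 1) / (d + 1)! = 0]. Multiplying by [d + 1 = l + (d + 1 - l)] splits the
    sum into two opposite ones. *)
Lemma diff_weight_sum (d : nat) : sum_n (diff_weight (S d)) (S d) = 0 :> C.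
Proof.
  assert (H : natC (S d) * sum_n (diff_weight (S d)) (S d) = 0 :> C).
  { rewrite <- csum_mult_l.
    rewrite (sum_n_ext_loc _ (fun l => diff_weight (S d) l * (natC l * 1)
                                   + diff_weight (S d) l * natC (S d - l))).
    - rewrite csum_plus, (diff_weight_mul_index d (fun _ => 1)),
        diff_weight_mul_coindex.
      rewrite (sum_n_ext _ (diff_weight d)); [cring | intros l; cring].
    - intros l Hl. rewrite Cmult_1_r, <- Cmult_plus_distr_l, <- natC_add.
      replace (l + (S d - l))%nat with (S d) by lia. cring. }
  replace (sum_n (diff_weight (S d)) (S d))
    with (/ natC (S d) * (natC (S d) * sum_n (diff_weight (S d)) (S d))).
  - rewrite H. cring.
  - cfield. apply natC_S_neq0.
Qed.

(** A polynomial in [l] of degree at most [m], kept as a product of affine factors of common slope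
    [p]. A shift of [l] only changes the constants [q]. *)
Fixpoint linear_prod (p : C) (q : nat -> C) (m l : nat) : C :=
  match m with
  | O => 1
  | S m' => linear_prod p q m' l * (p * natC l + q m')
  end.

Lemma linear_prod_shift (p : C) (q : nat -> C) (m l : nat) :
  linear_prod p q m (S l) = linear_prod p (fun i => q i + p) m l.
Proof.
  induction m as [|m IH]; simpl.
  - reflexivity.
  - rewrite IH, natC_S. cring.
Qed.

(** Induction on the number of factors, for all [d] and [q]. In the last factor, the part [p l]
    lowers [d] and shifts [l], and the constant part leaves a shorter product at the same [d]. *)
Lemma diff_weight_linear_prod (p : C) (m : nat) :
  forall (d : nat) (q : nat -> C), (m < d)%nat ->
  sum_n (fun l => diff_weight d l * linear_prod p q m l) d = 0 :> C.
Proof.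
  induction m as [|m IH]; intros [|d] q Hm; try lia.
  - rewrite <- (diff_weight_sum d). apply sum_n_ext. intros l. simpl. cring.
  - rewrite (sum_n_ext _ (fun l =>
      p * (diff_weight (S d) l * (natC l * linear_prod p q m l))
      + q m * (diff_weight (S d) l * linear_prod p q m l))).
    2:{ intros l. simpl. cring. }
    rewrite csum_plus, !csum_mult_l, diff_weight_mul_index, (IH (S d) q) by lia.
    rewrite (sum_n_ext _ (fun l => diff_weight d l
               * linear_prod p (fun i => q i + p) m l)).
    + rewrite IH by lia. cring.
    + intros l. rewrite linear_prod_shift. reflexivity.
Qed.

(** * Pochhammer symbols and the product of the two kernels *)

Lemma pochhammer_add (c : C) (m n : nat) :
  pochhammer c (m + n) = pochhammer c m * pochhammer (c + natC m) n.
Proof.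
  induction n as [|n IH].
  - rewrite Nat.add_0_r. simpl. cring.
  - rewrite Nat.add_succ_r. simpl. rewrite IH, natC_add. cring.
Qed.

Lemma pochhammer_S_l (c : C) (m : nat) :
  pochhammer c (S m) = c * pochhammer (c + 1) m.
Proof.
  change (S m) with (1 + m)%nat. rewrite pochhammer_add. simpl.
  unfold natC. simpl. rewrite !Cplus_0_r. cring.
Qed.

(** Each factor changes sign and the order of the factors is reversed. *)
Lemma pochhammer_opp (c : C) (m : nat) :
  pochhammer (- c) m = (-1) ^ m * pochhammer (c - natC m + 1) m.
Proof.
  revert c. induction m as [|m IH]; intros c.
  - simpl. cring.
  - rewrite pochhammer_S_l.
    replace (- c + 1) with (- (c - 1)) by cring.
    rewrite IH. simpl pochhammer. rewrite natC_S, Cpow_S.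
    replace (c - 1 - natC m + 1) with (c - (natC m + 1) + 1) by cring.
    replace (c - (natC m + 1) + 1 + natC m) with c by cring. cring.
Qed.

Lemma pochhammer_natC (n m : nat) :
  pochhammer (natC (S n)) m = factC (n + m) / factC n.
Proof.
  induction m as [|m IH].
  - rewrite Nat.add_0_r. simpl. cfield. apply factC_neq0.
  - simpl. rewrite IH, Nat.add_succ_r, factC_S, <- natC_add.
    simpl. cfield. apply factC_neq0.
Qed.

Lemma pochhammer_opp_natC (n m : nat) :
  pochhammer (- natC (n + m)) m = (-1) ^ m * (factC (n + m) / factC n).
Proof.
  rewrite pochhammer_opp. f_equal.
  replace (natC (n + m) - natC m + 1) with (natC (S n)).
  - apply pochhammer_natC.
  - rewrite natC_S, natC_add. cring.
Qed.

Lemma pochhammer_linear_prod (p c : C) (m l : nat) :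
  pochhammer (p * natC l + c) m = linear_prod p (fun i => c + natC i) m l.
Proof.
  induction m as [|m IH]; simpl.
  - reflexivity.
  - rewrite IH. cring.
Qed.

(** The factors [y, ..., y + i - 1] and [y - j + 1, ..., y] together form one run of [e = i + j - 1]
    consecutive factors, with [y] occurring once more. If [i] or [j] is 0, the extra [y] is the end
    of the run. *)
Lemma pochhammer_mul_falling (y : C) (i j e : nat) (hij : (i + j)%nat = S e) :
  pochhammer y i * pochhammer (y - natC j + 1) j =
  y * pochhammer (y - natC j + 1) e.
Proof.
  destruct j as [|j].
  - replace i with (S e) by lia. rewrite pochhammer_S_l.
    replace (y - natC 0 + 1) with (y + 1) by (unfold natC; simpl; cring).
    simpl. cring.
  - replace e with (j + i)%nat by lia.
    rewrite pochhammer_add. simpl (pochhammer _ (S j)).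
    replace (y - natC (S j) + 1 + natC j) with y by (rewrite natC_S; cring).
    cring.
Qed.

(* Matrices indexed from 1 are shifted: index [k] here stands for [k + 1] in the
   paper. The last argument is the distance to the diagonal. *)
Definition kerP (x nu : C) (k j : nat) : C :=
  Phi_coef (natC (S k) * nu) (natC (S k)) j * (- x) ^ j.

Definition kerQ (x nu : C) (n j : nat) : C :=
  Phi_coef (- natC (S n) * nu) (- natC (S n)) j * x ^ j.

Lemma Cpow_m1_sq (n : nat) : (-1) ^ n * (-1) ^ n = 1.
Proof.
  rewrite <- Cpow_mult_l. replace (-1 * -1) with (RtoC 1) by cring. apply Cpow_1_l.
Qed.

Lemma Cpow_opp_l (z : C) (n : nat) : (- z) ^ n = (-1) ^ n * z ^ n.
Proof. rewrite <- Cpow_mult_l. f_equal. cring. Qed.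

Lemma Cpow_m1_neq0 (n : nat) : (-1) ^ n <> 0.
Proof. apply Cpow_nz. intros H. apply RtoC_inj in H. lra. Qed.

(** Both numerators involve the same [y = (k + j + 1) nu], so they merge into [y] times [e]
    consecutive factors, each affine in [j] with slope [nu - 1]. The factorials and signs that
    depend on [j] form the weight of order [e + 1]. *)
Lemma kerP_kerQ_term (x nu : C) (k e j : nat) (hj : (j <= S e)%nat) :
  kerP x nu (k + j) (S e - j) * kerQ x nu (k + j) j =
  x ^ S e * nu * (factC (S k) / factC (k + S e))
  * (diff_weight (S e) j
     * linear_prod (nu - 1) (fun i => natC (S k) * nu + 1 + natC i) e j).
Proof.
  unfold kerP, kerQ, Phi_coef.
  set (i := (S e - j)%nat).
  set (y := natC (S (k + j)) * nu).
  replace (- natC (S (k + j)) * nu) with (- y) by (unfold y; cring).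
  rewrite (pochhammer_opp y).
  change (S (k + j)) with (S k + j)%nat at 2. rewrite pochhammer_opp_natC.
  rewrite (pochhammer_natC (k + j) i).
  replace (k + j + i)%nat with (k + S e)%nat by (unfold i; lia).
  rewrite <- pochhammer_linear_prod.
  replace ((nu - 1) * natC j + (natC (S k) * nu + 1)) with (y - natC j + 1)
    by (unfold y; rewrite !natC_S, natC_add; cring).
  assert (Hf := pochhammer_mul_falling y i j e ltac:(unfold i; lia)).
  assert (Hx : x ^ S e = x ^ i * x ^ j).
  { rewrite <- Cpow_add_r. f_equal. unfold i. lia. }
  rewrite Hx, Cpow_opp_l. unfold diff_weight. fold i.
  change (S k + j)%nat with (S (k + j)). rewrite (factC_S (k + j)).
  (* The denominators leave a factor [1 / (k + j + 1)], which turns the extra [y] into [nu],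
     independent of [j]. *)
  assert (Hy : y / natC (S (k + j)) = nu).
  { unfold y. cfield. apply natC_S_neq0. }
  rewrite <- Hy at 1.
  transitivity ((pochhammer y i * pochhammer (y - natC j + 1) j)
    * ((-1) ^ i * x ^ i * x ^ j * factC (S k)
       / (factC (k + S e) * natC (S (k + j)) * factC i * factC j))).
  - cfield. repeat split; auto using factC_neq0, natC_S_neq0, Cpow_m1_neq0.
  - rewrite Hf. cfield.
    repeat split; auto using factC_neq0, natC_S_neq0, Cpow_m1_neq0.
Qed.

Lemma kerP_kerQ (x nu : C) (k d : nat) :
  sum_n (fun j => kerP x nu (k + j) (d - j) * kerQ x nu (k + j) j) d =
  delta0 d.
Proof.
  destruct d as [|e].
  - rewrite sum_O. unfold kerP, kerQ, Phi_coef, factC, natC, delta0. simpl. cfield.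
  - rewrite (sum_n_ext_loc _ _ _ (fun j Hj => kerP_kerQ_term x nu k e j Hj)).
    rewrite csum_mult_l, diff_weight_linear_prod by lia. unfold delta0. simpl. cring.
Qed.

(* [tri_apply h u] applies the lower triangular matrix whose [(n, k)] entry is
   [h n k (n - k)]. *)
Definition tri_apply (h : nat -> nat -> nat -> C) (u : nat -> C) (n : nat) : C :=
  sum_n (fun k => u k * h n k (n - k)%nat) n.

Lemma tri_apply_comp (g h : nat -> nat -> nat -> C) (u : nat -> C) (n : nat) :
  tri_apply g (tri_apply h u) n =
  sum_n (fun k => u k *
    sum_n (fun j => g n (k + j)%nat (n - k - j)%nat * h (k + j)%nat k j)
      (n - k)) n.
Proof.
  unfold tri_apply.
  rewrite (sum_n_ext _ (fun l => sum_n (fun k =>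
    u k * h l k (l - k)%nat * g n l (n - l)%nat) l)).
  2:{ intros l. rewrite csum_mult_r. reflexivity. }
  rewrite (csum_triangle (fun l k => u k * h l k (l - k)%nat * g n l (n - l)%nat)).
  apply sum_n_ext. intros k. rewrite <- csum_mult_l. apply sum_n_ext. intros j.
  replace (k + j - k)%nat with j by lia.
  replace (n - (k + j))%nat with (n - k - j)%nat by lia. cring.
Qed.

Lemma tri_apply_inverse (g h : nat -> nat -> nat -> C) :
  (forall n k d, n = (k + d)%nat ->
    sum_n (fun j => g n (k + j)%nat (d - j)%nat * h (k + j)%nat k j) d
    = delta0 d) ->
  forall u n, tri_apply g (tri_apply h u) n = u n.
Proof.
  intros H u n. rewrite tri_apply_comp. rewrite <- (csum_delta u n).
  apply sum_n_ext_loc. intros k Hk. f_equal. apply H. lia.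
Qed.

(** Forward substitution: with ones on the diagonal, row [n] determines [u n] from the earlier
    values. *)
Lemma tri_apply_inj (g : nat -> nat -> nat -> C) (u v : nat -> C) :
  (forall n, g n n 0%nat = 1) ->
  (forall n, tri_apply g u n = tri_apply g v n) -> forall n, u n = v n.
Proof.
  intros Hg H. intros n. induction n as [n IH] using (well_founded_ind lt_wf).
  specialize (H n). unfold tri_apply in H. destruct n as [|n].
  - rewrite !sum_O in H. simpl in H. rewrite Hg, !Cmult_1_r in H. exact H.
  - rewrite !csum_S, Nat.sub_diag, Hg, !Cmult_1_r in H.
    rewrite (sum_n_ext_loc _ (fun k => v k * g (S n) k (S n - k)%nat)) in H.
    + set (w := sum_n _ n) in H.
      replace (u (S n)) with (w + u (S n) - w) by cring.
      rewrite H. cring.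
    + intros k Hk. rewrite IH by lia. reflexivity.
Qed.

(** [mxP] depends on the column and [mxQ] on the row, besides the distance [j]. [mxE w] depends on
    [j] alone: it is multiplication of a power series in [z] by [exp (w z)]. *)
Definition mxP (x nu : C) (n k j : nat) : C := kerP x nu k j.
Definition mxQ (x nu : C) (n k j : nat) : C := kerQ x nu n j.
Definition mxE (w : C) (n k j : nat) : C := w ^ j / factC j.

(** The entry at distance [d] is the binomial expansion of [(w - w) ^ d / d!]. *)
Lemma mxE_opp (w : C) (u : nat -> C) (n : nat) :
  tri_apply (mxE w) (tri_apply (mxE (- w)) u) n = u n.
Proof.
  apply tri_apply_inverse. clear. intros n k d _. unfold mxE.
  transitivity (w ^ d * ((-1) ^ d * sum_n (diff_weight d) d)).
  - rewrite <- !csum_mult_l. apply sum_n_ext_loc. intros j Hj.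
    assert (Hd : forall c : C, c ^ d = c ^ (d - j) * c ^ j).
    { intros c. rewrite <- Cpow_add_r. f_equal. lia. }
    rewrite !Hd, Cpow_opp_l. unfold diff_weight.
    transitivity (((-1) ^ (d - j) * (-1) ^ (d - j))
      * (w ^ (d - j) * w ^ j * (-1) ^ j / (factC j * factC (d - j)))).
    + rewrite Cpow_m1_sq. cfield. auto using factC_neq0.
    + cfield. auto using factC_neq0.
  - destruct d as [|d].
    + rewrite sum_O. unfold diff_weight, factC, natC, delta0. simpl. cfield.
    + rewrite diff_weight_sum. unfold delta0. simpl. cring.
Qed.

Lemma mxP_mxQ (x nu : C) (u : nat -> C) (n : nat) :
  tri_apply (mxP x nu) (tri_apply (mxQ x nu) u) n = u n.
Proof.
  apply tri_apply_inverse. clear. intros n k d _. apply kerP_kerQ.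
Qed.

(** A right inverse of an injective map is also a left inverse, so no second summation identity has
    to be proved. *)
Lemma mxQ_mxP (x nu : C) (u : nat -> C) (n : nat) :
  tri_apply (mxQ x nu) (tri_apply (mxP x nu) u) n = u n.
Proof.
  revert n. apply (tri_apply_inj (mxP x nu)).
  - intros n. unfold mxP, kerP, Phi_coef, factC, natC. simpl. cfield.
  - intros n. apply mxP_mxQ.
Qed.

(** * Factorization of the two relations *)

Lemma hypF_div_factC (j : nat) (b c x : C) :
  hypF j b c x / factC j =
  sum_n (fun m => Phi_coef b c m * (- x) ^ m / factC (j - m)) j.
Proof.
  unfold hypF, Cdiv. rewrite <- csum_mult_r. apply sum_n_ext_loc. intros m Hm.
  replace (pochhammer (- natC j) m) with ((-1) ^ m * (factC j / factC (j - m))).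
  - rewrite Cpow_opp_l. unfold Phi_coef, Cdiv.
    transitivity (pochhammer b m * / (pochhammer c m * factC m)
      * (-1) ^ m * x ^ m * (factC j * / factC j) * / factC (j - m)); [cring|].
    rewrite Cinv_r by apply factC_neq0. cring.
  - replace j with ((j - m) + m)%nat at 1 3 by lia.
    symmetry. apply pochhammer_opp_natC.
Qed.

Lemma binC_S (n k : nat) (hk : (k <= n)%nat) :
  binC (S n) (S k) = factC (S n) / (factC (S k) * factC (n - k)).
Proof.
  unfold binC, Binomial.C, factC, natC. rewrite RtoC_div, RtoC_mult.
  - reflexivity.
  - apply Rmult_integral_contrapositive; split; apply INR_fact_neq_0.
Qed.

Section Normal_form.

Variables (x nu : C) (s t : nat -> C).

Let a (n : nat) : C := s (S n) / factC (S n).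
Let b (n : nat) : C := (-1) ^ S n * t (S n) / factC (S n).

Lemma is_image_matB_normal :
  is_image (matB x nu) t s ->
  forall n, a n = tri_apply (mxE 1) (tri_apply (mxP x nu) b) n.
Proof.
  intros H n. unfold a. rewrite (H (S n)) by lia.
  rewrite csum_m_1, tri_apply_comp. unfold Cdiv. rewrite <- csum_mult_r.
  apply sum_n_ext_loc. intros k Hk. unfold matB, b.
  simpl Nat.sub. rewrite (binC_S n k Hk).
  transitivity ((-1) ^ S k * t (S k) / factC (S k)
    * (hypF (n - k) (natC (S k) * nu) (natC (S k)) x / factC (n - k))).
  - cfield. repeat split; apply factC_neq0.
  - rewrite hypF_div_factC. f_equal. apply sum_n_ext. intros j.
    unfold mxE, mxP, kerP. rewrite Cpow_1_l. unfold Cdiv. cring.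
Qed.

Lemma is_image_matA_normal :
  is_image (matA x nu) s t ->
  forall n, b n = tri_apply (mxQ x nu) (tri_apply (mxE (- (1))) a) n.
Proof.
  intros H n. unfold b. rewrite (H (S n)) by lia.
  rewrite csum_m_1, tri_apply_comp. unfold Cdiv.
  rewrite <- Cmult_assoc, <- csum_mult_r, <- csum_mult_l.
  apply sum_n_ext_loc. intros k Hk. unfold matA, a.
  simpl Nat.sub. rewrite (binC_S n k Hk).
  transitivity (s (S k) / factC (S k) * ((-1) ^ S n * (-1) ^ S k
    * (hypF (n - k) (- natC (S n) * nu) (- natC (S n)) x / factC (n - k)))).
  - cfield. repeat split; apply factC_neq0.
  - rewrite hypF_div_factC, <- csum_mult_l. f_equal.
    (* The exponential factor now stands on the right of the matrix product, so the convolution is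
       read in the reverse order. *)
    rewrite sum_n_rev. apply sum_n_ext_loc. intros j Hj.
    unfold mxE, mxQ, kerQ. rewrite !Cpow_opp_l, Cpow_1_l.
    replace (n - k - (n - k - j))%nat with j by lia.
    (* The sign [(-1) ^ (n + 1)] is split so that all signs pair into squares, except the [(-1) ^ j]
       that belongs to [mxE (- (1))]. *)
    replace (S n) with ((n - k - j) + (j + S k))%nat at 1 by lia.
    rewrite !Cpow_add_r.
    transitivity (((-1) ^ (n - k - j) * (-1) ^ (n - k - j))
      * ((-1) ^ S k * (-1) ^ S k)
      * (Phi_coef (- natC (S n) * nu) (- natC (S n)) (n - k - j)
         * x ^ (n - k - j) * ((-1) ^ j / factC j))).
    + unfold Cdiv. cring.
    + rewrite !Cpow_m1_sq. unfold Cdiv. cring.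
Qed.

Lemma tri_apply_ext (h : nat -> nat -> nat -> C) (u v : nat -> C) (n : nat) :
  (forall k, u k = v k) -> tri_apply h u n = tri_apply h v n.
Proof.
  intros H. apply sum_n_ext. intros k. rewrite H. reflexivity.
Qed.

Lemma is_image_normal :
  is_image (matB x nu) t s \/ is_image (matA x nu) s t ->
  forall n, a n = tri_apply (mxE 1) (tri_apply (mxP x nu) b) n.
Proof.
  intros [H|H] n.
  - apply is_image_matB_normal, H.
  (* From [b = Q E^-1 a] one gets [P b = E^-1 a], hence [E P b = a]. *)
  - rewrite <- (mxE_opp 1 a n). apply tri_apply_ext. intros k.
    rewrite <- (mxP_mxQ x nu). apply tri_apply_ext. intros i. symmetry.
    apply is_image_matA_normal, H.
Qed.

End Normal_form.

(** Conjugation by a diagonal matrix: [z ^ (n + 1) = z ^ (k + 1) * z ^ (n - k)]. *)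
Lemma tri_apply_scale (h : nat -> nat -> nat -> C) (u : nat -> C) (z : C) (n : nat) :
  tri_apply h u n * z ^ S n =
  tri_apply (fun n k j => h n k j * z ^ j) (fun k => u k * z ^ S k) n.
Proof.
  unfold tri_apply. rewrite <- csum_mult_r. apply sum_n_ext_loc. intros k Hk.
  replace (S n) with (S k + (n - k))%nat at 1 by lia. rewrite Cpow_add_r. cring.
Qed.

(** * Series in [C] *)

(** Complex convergence is phrased through a real null sequence, so that real comparison arguments
    apply. *)
Definition clim (u : nat -> C) (l : C) : Prop :=
  is_lim_seq (fun n => Cmod (u n - l)) 0.

Lemma is_lim_seq_0_iff (v : nat -> R) :
  (forall n, 0 <= v n)%R ->
  is_lim_seq v 0 <->
  (forall eps : R, (0 < eps)%R -> exists N, forall n, (N <= n)%nat -> (v n < eps)%R).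
Proof.
  intros Hv. rewrite <- is_lim_seq_spec. split; intros H.
  - intros eps Heps. destruct (H (mkposreal eps Heps)) as [N HN].
    exists N. intros n Hn. specialize (HN n Hn). simpl in HN.
    rewrite Rminus_0_r, Rabs_pos_eq in HN by apply Hv. exact HN.
  - intros eps. destruct (H eps (cond_pos eps)) as [N HN].
    exists N. intros n Hn. rewrite Rminus_0_r, Rabs_pos_eq by apply Hv. auto.
Qed.

Lemma is_lim_seq_0_le (u v : nat -> R) :
  (forall n, 0 <= u n <= v n)%R -> is_lim_seq v 0 -> is_lim_seq u 0.
Proof.
  intros H Hv. apply (is_lim_seq_le_le (fun _ => 0%R) u v); auto.
  apply is_lim_seq_const.
Qed.

Lemma Cmod_triangle_minus (x y z : C) :
  (Cmod (x - z) <= Cmod (x - y) + Cmod (y - z))%R.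
Proof.
  replace (x - z) with ((x - y) + (y - z)) by cring. apply Cmod_triangle.
Qed.

Lemma Cmod_minus_sym (x y : C) : Cmod (x - y) = Cmod (y - x).
Proof. rewrite <- Cmod_opp. f_equal. cring. Qed.

Lemma is_series_clim (a : nat -> C) (l : C) :
  is_series (a : nat -> C_NormedModule) l <-> clim (sum_n a) l.
Proof.
  unfold clim. split.
  - intros H. apply is_lim_seq_0_iff; [intros; apply Cmod_ge_0|].
    intros eps Heps.
    destruct (proj1 (filterlim_locally_ball_norm _ _) H (mkposreal eps Heps)) as [N HN].
    exists N. intros n Hn. exact (HN n Hn).
  - intros H. apply filterlim_locally_ball_norm. intros eps.
    destruct (proj1 (is_lim_seq_0_iff _ (fun n => Cmod_ge_0 _)) H eps (cond_pos eps))
      as [N HN].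
    exists N. intros n Hn. exact (HN n Hn).
Qed.

Lemma clim_le (u v : nat -> C) (l : C) :
  is_lim_seq (fun n => Cmod (u n - v n)) 0 -> clim v l -> clim u l.
Proof.
  intros Huv Hv.
  apply (is_lim_seq_0_le _ (fun n => (Cmod (u n - v n) + Cmod (v n - l))%R)).
  - intros n. split. apply Cmod_ge_0. apply Cmod_triangle_minus.
  - replace (Finite 0) with (Finite (0 + 0)) by (f_equal; ring).
    apply is_lim_seq_plus'; assumption.
Qed.

(** Meant for [f = Re] and [f = Im]. *)
Lemma is_lim_seq_clim (u : nat -> C) (l : C) (f : C -> R) :
  (forall z w : C, f (z - w) = (f z - f w)%R) -> (forall z : C, Rabs (f z) <= Cmod z)%R ->
  clim u l -> is_lim_seq (fun n => f (u n)) (f l).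
Proof.
  intros Hf Hle H. apply is_lim_seq_spec. intros eps.
  destruct (proj1 (is_lim_seq_0_iff _ (fun n => Cmod_ge_0 _)) H eps (cond_pos eps))
    as [N HN].
  exists N. intros n Hn. simpl. rewrite <- Hf.
  eapply Rle_lt_trans; [apply Hle | apply HN, Hn].
Qed.

Lemma Re_csum (a : nat -> C) (n : nat) :
  Re (sum_n a n) = sum_n (fun k => Re (a k)) n.
Proof.
  induction n as [|n IH].
  - rewrite !sum_O. reflexivity.
  - rewrite csum_S, sum_Sn, <- IH. reflexivity.
Qed.

Lemma Im_csum (a : nat -> C) (n : nat) :
  Im (sum_n a n) = sum_n (fun k => Im (a k)) n.
Proof.
  induction n as [|n IH].
  - rewrite !sum_O. reflexivity.
  - rewrite csum_S, sum_Sn, <- IH. reflexivity.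
Qed.

Lemma CSeries_unique (a : nat -> C) (l : C) :
  is_series (a : nat -> C_NormedModule) l -> CSeries a = l.
Proof.
  intros H. apply is_series_clim in H. unfold CSeries.
  rewrite (is_series_unique (fun n => Re (a n)) (Re l)),
    (is_series_unique (fun n => Im (a n)) (Im l)).
  - destruct l. reflexivity.
  - change (is_lim_seq (sum_n (fun n => Im (a n))) (Im l)).
    apply (is_lim_seq_ext _ _ _ (Im_csum a)).
    apply (is_lim_seq_clim _ _ Im); auto.
    intros z. eapply Rle_trans; [apply Rmax_r | apply Rmax_Cmod].
  - change (is_lim_seq (sum_n (fun n => Re (a n))) (Re l)).
    apply (is_lim_seq_ext _ _ _ (Re_csum a)).
    apply (is_lim_seq_clim _ _ Re); auto. apply re_le_Cmod.
Qed.

Lemma is_series_null (a : nat -> C) (l : C) :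
  is_series (a : nat -> C_NormedModule) l -> is_lim_seq (fun n => Cmod (a n)) 0.
Proof.
  intros H. apply is_series_clim in H.
  apply is_lim_seq_incr_1.
  apply (is_lim_seq_0_le _ (fun n =>
    (Cmod (sum_n a (S n) - l) + Cmod (sum_n a n - l))%R)).
  - intros n. split; [apply Cmod_ge_0|]. rewrite csum_S.
    rewrite (Cmod_minus_sym (sum_n a n)).
    replace (a (S n)) with (sum_n a n + a (S n) - sum_n a n) at 1 by cring.
    apply Cmod_triangle_minus.
  - replace (Finite 0) with (Finite (0 + 0)) by (f_equal; ring).
    apply is_lim_seq_plus'; [|exact H].
    apply (is_lim_seq_incr_1 (fun n => Cmod (sum_n a n - l))). exact H.
Qed.

Lemma is_series_mult_r (a : nat -> C) (l c : C) :
  is_series (a : nat -> C_NormedModule) l ->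
  is_series ((fun n => a n * c) : nat -> C_NormedModule) (l * c).
Proof.
  intros H. rewrite Cmult_comm.
  apply (is_series_ext (fun n => c * a n : C_NormedModule)).
  { intros n. apply Cmult_comm. }
  exact (is_series_scal c a l H).
Qed.

(** * Majorants by terms of the exponential series *)

Definition expt (rho : R) (j : nat) : R := (rho ^ j / INR (fact j))%R.

Lemma expt_ge_0 (rho : R) (j : nat) : (0 <= rho)%R -> (0 <= expt rho j)%R.
Proof.
  intros H. apply Rdiv_le_0_compat. apply pow_le, H. apply INR_fact_lt_0.
Qed.

Lemma is_series_expt (rho : R) : is_series (expt rho) (exp rho).
Proof.
  apply (is_series_ext (fun n => (/ INR (fact n) * rho ^ n)%R)).
  { intros n. unfold expt, Rdiv. apply Rmult_comm. }
  apply is_pseries_R, is_exp_Reals.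
Qed.

Lemma expt_sum_le (rho : R) (n : nat) :
  (0 <= rho)%R -> (sum_n (expt rho) n <= exp rho)%R.
Proof.
  intros H.
  apply (is_lim_seq_incr_compare (sum_n (expt rho)) (exp rho)).
  - apply is_series_expt.
  - intros k. rewrite sum_Sn. unfold plus; simpl.
    generalize (expt_ge_0 rho (S k) H). lra.
Qed.

Lemma expt_mult (c rho : R) (j : nat) : expt (c * rho) j = (c ^ j * expt rho j)%R.
Proof. unfold expt. rewrite Rpow_mult_distr. unfold Rdiv. ring. Qed.

Lemma fact_mul_le (n i : nat) : (fact n * fact i <= fact (n + i))%nat.
Proof.
  induction i as [|i IH].
  - rewrite Nat.add_0_r. simpl. lia.
  - rewrite Nat.add_succ_r. rewrite !fact_simpl. nia.
Qed.

(** Since [n! i! <= (n + i)!], the tail of the exponential series from [n] on is at most its [n]-th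
    term times [exp rho]. *)
Lemma expt_add_le (rho : R) (n i : nat) :
  (0 <= rho)%R -> (expt rho (n + i) <= expt rho n * expt rho i)%R.
Proof.
  intros H. unfold expt.
  replace (rho ^ n / INR (fact n) * (rho ^ i / INR (fact i)))%R
    with (rho ^ (n + i) / INR (fact n * fact i))%R.
  - apply Rmult_le_compat_l; [apply pow_le, H|].
    apply Rinv_le_contravar; [|apply le_INR, fact_mul_le].
    rewrite mult_INR. apply Rmult_lt_0_compat; apply INR_fact_lt_0.
  - rewrite mult_INR, pow_add. field. split; apply INR_fact_neq_0.
Qed.

Lemma sum_n_le (u v : nat -> R) (n : nat) :
  (forall k, (k <= n)%nat -> u k <= v k)%R -> (sum_n u n <= sum_n v n)%R.
Proof.
  induction n as [|n IH]; intros H.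
  - rewrite !sum_O. apply H. lia.
  - rewrite !sum_Sn. apply Rplus_le_compat; [apply IH; intros; apply H|apply H]; lia.
Qed.

Lemma rsum_mult_l (c : R) (u : nat -> R) (n : nat) :
  sum_n (fun k => (c * u k)%R) n = (c * sum_n u n)%R.
Proof. exact (sum_n_mult_l c u n). Qed.

Lemma rsum_plus (u v : nat -> R) (n : nat) :
  sum_n (fun k => (u k + v k)%R) n = (sum_n u n + sum_n v n)%R.
Proof. exact (sum_n_plus u v n). Qed.

Lemma Cmod_csum_le (a : nat -> C) (n : nat) :
  (Cmod (sum_n a n) <= sum_n (fun k => Cmod (a k)) n)%R.
Proof.
  induction n as [|n IH].
  - rewrite !sum_O. apply Rle_refl.
  - rewrite csum_S, sum_Sn. eapply Rle_trans; [apply Cmod_triangle|].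
    apply Rplus_le_compat_r, IH.
Qed.

Lemma clim_Cmod_le (u : nat -> C) (l c : C) (K : R) :
  clim u l -> (exists N, forall n, (N <= n)%nat -> Cmod (u n - c) <= K)%R ->
  (Cmod (l - c) <= K)%R.
Proof.
  intros H [N HN]. apply le_epsilon. intros eps Heps.
  destruct (proj1 (is_lim_seq_0_iff _ (fun n => Cmod_ge_0 _)) H eps Heps) as [N' HN'].
  specialize (HN (max N N') ltac:(lia)). specialize (HN' (max N N') ltac:(lia)).
  simpl in HN'. rewrite Cmod_minus_sym in HN'.
  generalize (Cmod_triangle_minus l (u (max N N')) c). lra.
Qed.

Lemma series_Cmod_le (f : nat -> C) (l : C) (c rho : R) :
  (0 <= rho)%R -> (0 <= c)%R ->
  (forall j, Cmod (f j) <= c * expt rho j)%R ->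
  is_series (f : nat -> C_NormedModule) l -> (Cmod l <= c * exp rho)%R.
Proof.
  intros Hr Hc Hf H. apply is_series_clim in H.
  replace l with (l - 0) by cring. apply (clim_Cmod_le _ _ _ _ H).
  exists 0%nat. intros n _. unfold Cminus. rewrite Copp_0, Cplus_0_r.
  eapply Rle_trans; [apply Cmod_csum_le|].
  eapply Rle_trans; [apply sum_n_le; intros k _; apply Hf|].
  rewrite (rsum_mult_l c (expt rho) n).
  apply Rmult_le_compat_l; [exact Hc | apply expt_sum_le, Hr].
Qed.

Lemma series_tail_le (f : nat -> C) (l : C) (rho : R) (n : nat) :
  (0 <= rho)%R -> (forall j, Cmod (f j) <= expt rho j)%R ->
  is_series (f : nat -> C_NormedModule) l ->
  (Cmod (l - sum_n f n) <= exp rho * expt rho n)%R.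
Proof.
  intros Hr Hf H. apply is_series_clim in H. apply (clim_Cmod_le _ _ _ _ H).
  exists n. intros m Hm. replace m with (n + (m - n))%nat by lia.
  rewrite Rmult_comm.
  assert (Hp : forall p, (Cmod (sum_n f (n + p)%nat - sum_n f n)
                          <= expt rho n * sum_n (expt rho) p)%R).
  { induction p as [|p IH].
    - rewrite Nat.add_0_r, sum_O.
      replace (sum_n f n - sum_n f n) with (RtoC 0) by cring. rewrite Cmod_0.
      apply Rmult_le_pos; apply expt_ge_0, Hr.
    - rewrite Nat.add_succ_r, csum_S, sum_Sn.
      replace (sum_n f (n + p)%nat + f (S (n + p)) - sum_n f n)
        with ((sum_n f (n + p)%nat - sum_n f n) + f (S (n + p))) by cring.
      eapply Rle_trans; [apply Cmod_triangle|].
      unfold plus; simpl. rewrite Rmult_plus_distr_l.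
      apply Rplus_le_compat; [exact IH|].
      eapply Rle_trans; [apply Hf|]. rewrite <- Nat.add_succ_r.
      apply expt_add_le, Hr. }
  eapply Rle_trans; [apply Hp|].
  apply Rmult_le_compat_l; [apply expt_ge_0, Hr | apply expt_sum_le, Hr].
Qed.

Lemma ex_series_expt (f : nat -> C) (rho : R) :
  (forall j, Cmod (f j) <= expt rho j)%R ->
  is_series (f : nat -> C_NormedModule) (CSeries f).
Proof.
  intros Hf.
  destruct (ex_series_le (f : nat -> C_CompleteNormedModule) (expt rho)) as [l Hl].
  - exact Hf.
  - exists (exp rho). apply is_series_expt.
  - rewrite (CSeries_unique f l Hl). exact Hl.
Qed.

(* Either [k] is large, so [v k] is small, or [n - k] is large, and then
   [2 ^ (n - k)] absorbs the loss, at the price of [exp (2 rho)]. *)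
Lemma null_convolution (v : nat -> R) (rho : R) :
  (0 <= rho)%R -> (forall n, 0 <= v n)%R -> is_lim_seq v 0 ->
  is_lim_seq (fun n => sum_n (fun k => v k * expt rho (n - k))%R n) 0.
Proof.
  intros Hr Hv H.
  destruct (filterlim_bounded v (ex_intro _ 0%R H)) as [K HK].
  assert (HvK : forall n, (v n <= K)%R).
  { intros n. eapply Rle_trans; [apply Rle_abs | apply HK]. }
  assert (HK0 : (0 <= K)%R) by (eapply Rle_trans; [apply (Hv 0%nat) | apply HvK]).
  apply is_lim_seq_0_iff.
  { intros n. rewrite <- (Rmult_0_r (INR (S n))), <- sum_n_const.
    apply sum_n_le. intros k _. apply Rmult_le_pos; [apply Hv | apply expt_ge_0, Hr]. }
  intros eps Heps.
  (* The two majorants have total mass at most [exp rho + K * exp (2 * rho)]; adding 1 makes the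
     divisor clearly positive and the final inequality strict. *)
  set (d := (eps / (2 * (exp rho + K * exp (2 * rho) + 1)))%R).
  assert (HD : (0 < exp rho + K * exp (2 * rho) + 1)%R).
  { generalize (exp_pos rho) (Rmult_le_pos _ _ HK0 (Rlt_le _ _ (exp_pos (2 * rho)))).
    lra. }
  assert (Hd : (0 < d)%R) by (apply Rdiv_lt_0_compat; lra).
  destruct (proj1 (is_lim_seq_0_iff _ Hv) H d Hd) as [N HN].
  destruct (pow_lt_1_zero (/ 2) ltac:(rewrite Rabs_pos_eq; lra) d Hd) as [J HJ].
  exists (N + J)%nat. intros n Hn.
  apply Rle_lt_trans with (d * (exp rho + K * exp (2 * rho)))%R.
  (* Bounding every term by the sum of the bounds for the two cases avoids splitting the sum at
     [N]. *)
  - apply Rle_trans with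
      (sum_n (fun k => d * expt rho (n - k) + d * (K * expt (2 * rho) (n - k)))%R n).
    + apply sum_n_le. intros k Hk.
      assert (H0 := expt_ge_0 rho (n - k) Hr).
      assert (H1 := expt_ge_0 (2 * rho) (n - k) ltac:(lra)).
      assert (HkN : (N <= k \/ k < N)%nat) by lia. destruct HkN as [HkN|HkN].
      * apply Rle_trans with (d * expt rho (n - k))%R.
        -- apply Rmult_le_compat_r; [exact H0 | left; apply HN, HkN].
        -- rewrite <- (Rplus_0_r (d * expt rho (n - k))) at 1.
           apply Rplus_le_compat_l.
           apply Rmult_le_pos; [lra | apply Rmult_le_pos; assumption].
      * apply Rle_trans with (d * (K * expt (2 * rho) (n - k)))%R.
        -- rewrite expt_mult.
           (* As [k < N] and [N + J <= n], the distance is at least [J], so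
              [(1 / 2) ^ (n - k) < d]. *)
           assert (HdJ : (1 <= d * 2 ^ (n - k))%R).
           { assert (HnkJ : (J <= n - k)%nat) by lia. specialize (HJ (n - k)%nat HnkJ).
             rewrite pow_inv, Rabs_pos_eq in HJ
               by (left; apply Rinv_0_lt_compat, pow_lt; lra).
             assert (Hp := pow_lt 2 (n - k) ltac:(lra)).
             apply Rmult_le_reg_r with (/ 2 ^ (n - k))%R.
             apply Rinv_0_lt_compat, Hp.
             rewrite Rmult_assoc, Rinv_r by lra. lra. }
           replace (d * (K * (2 ^ (n - k) * expt rho (n - k))))%R
             with ((d * 2 ^ (n - k)) * (K * expt rho (n - k)))%R by ring.
           apply Rle_trans with (1 * (K * expt rho (n - k)))%R.
           ++ rewrite Rmult_1_l. apply Rmult_le_compat_r; auto.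
           ++ apply Rmult_le_compat_r; [apply Rmult_le_pos; auto | exact HdJ].
        -- generalize (Rmult_le_pos _ _ (Rlt_le _ _ Hd) H0). lra.
    + assert (Hrev : forall c : R, sum_n (fun k => expt c (n - k)) n = sum_n (expt c) n).
      { intros c. symmetry. apply (sum_n_rev (expt c)). }
      rewrite (rsum_plus (fun k => d * expt rho (n - k))%R).
      rewrite (rsum_mult_l d (fun k => expt rho (n - k))).
      rewrite (rsum_mult_l d (fun k => K * expt (2 * rho) (n - k))%R).
      rewrite (rsum_mult_l K (fun k => expt (2 * rho) (n - k))).
      rewrite !Hrev,  Rmult_plus_distr_l.
      apply Rplus_le_compat; repeat apply Rmult_le_compat_l; try lra;
        apply expt_sum_le; lra.
  - unfold d. apply Rmult_lt_reg_r with (exp rho + K * exp (2 * rho) + 1)%R; [exact HD|].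
    replace (eps / (2 * (exp rho + K * exp (2 * rho) + 1)) * (exp rho + K * exp (2 * rho))
      * (exp rho + K * exp (2 * rho) + 1))%R
      with (eps / 2 * (exp rho + K * exp (2 * rho)))%R by (field; lra).
    apply Rlt_le_trans with (eps / 2 * (exp rho + K * exp (2 * rho) + 1))%R.
    + apply Rmult_lt_compat_l; lra.
    + apply Rmult_le_compat_r; lra.
Qed.

(** * Summation of triangular transforms *)

Lemma tri_apply_null (h : nat -> nat -> nat -> C) (u : nat -> C) (rho : R) :
  (0 <= rho)%R ->
  (forall n k j, n = (k + j)%nat -> (Cmod (h n k j) <= expt rho j)%R) ->
  is_lim_seq (fun n => Cmod (u n)) 0 ->
  is_lim_seq (fun n => Cmod (tri_apply h u n)) 0.
Proof.
  intros Hr Hh Hu.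
  apply (is_lim_seq_0_le _
    (fun n => sum_n (fun k => Cmod (u k) * expt rho (n - k))%R n)).
  - intros n. split; [apply Cmod_ge_0|]. unfold tri_apply.
    eapply Rle_trans; [apply Cmod_csum_le|]. apply sum_n_le. intros k Hk.
    rewrite Cmod_mult. apply Rmult_le_compat_l; [apply Cmod_ge_0|].
    apply Hh. lia.
  - apply null_convolution; auto. intros n. apply Cmod_ge_0.
Qed.

(** Summed by columns, the first [n] rows show column [k] truncated at distance [n - k]. *)
Lemma csum_tri_apply (h : nat -> nat -> C) (u : nat -> C) (n : nat) :
  sum_n (tri_apply (fun _ k j => h k j) u) n =
  sum_n (fun k => u k * sum_n (h k) (n - k)) n.
Proof.
  unfold tri_apply. rewrite (csum_triangle (fun l k => u k * h k (l - k)%nat)).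
  apply sum_n_ext. intros k. rewrite <- csum_mult_l. apply sum_n_ext. intros j.
  do 2 f_equal. lia.
Qed.

(* The two partial sums differ by a convolution of the null sequence [u] with
   the tails of the series of the [h k]. *)
Lemma tri_apply_series (h : nat -> nat -> C) (H u : nat -> C) (rho : R) (l : C) :
  (0 <= rho)%R -> (forall k j, Cmod (h k j) <= expt rho j)%R ->
  (forall k, is_series (h k : nat -> C_NormedModule) (H k)) ->
  is_lim_seq (fun n => Cmod (u n)) 0 ->
  is_series (tri_apply (fun _ k j => h k j) u : nat -> C_NormedModule) l <->
  is_series ((fun k => u k * H k) : nat -> C_NormedModule) l.
Proof.
  intros Hr Hh HH Hu.
  assert (D : is_lim_seq (fun n =>
    Cmod (sum_n (fun k => u k * H k) n - sum_n (tri_apply (fun _ k j => h k j) u) n)) 0).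
  { apply (is_lim_seq_0_le _ (fun n =>
      exp rho * sum_n (fun k => Cmod (u k) * expt rho (n - k)) n)%R).
    - intros n. split; [apply Cmod_ge_0|].
      rewrite csum_tri_apply, <- csum_minus, <- rsum_mult_l.
      eapply Rle_trans; [apply Cmod_csum_le|]. apply sum_n_le. intros k Hk.
      replace (u k * H k - u k * sum_n (h k) (n - k))
        with (u k * (H k - sum_n (h k) (n - k)%nat)) by cring.
      rewrite Cmod_mult.
      replace (exp rho * (Cmod (u k) * expt rho (n - k)))%R
        with (Cmod (u k) * (exp rho * expt rho (n - k)))%R by ring.
      apply Rmult_le_compat_l; [apply Cmod_ge_0|].
      apply series_tail_le; auto.
    - replace (Finite 0) with (Rbar_mult (exp rho) 0)
        by (simpl; f_equal; ring).
      apply is_lim_seq_scal_l. apply null_convolution; auto.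
      intros n. apply Cmod_ge_0. }
  rewrite !is_series_clim. split; intros Hl; refine (clim_le _ _ _ _ Hl).
  - exact D.
  - apply (is_lim_seq_ext _ _ _ (fun n => Cmod_minus_sym _ _) D).
Qed.

Lemma Cmod_factC (n : nat) : Cmod (factC n) = INR (fact n).
Proof. apply Cmod_natC. Qed.

Lemma Cmod_expt (z : C) (j : nat) : Cmod (z ^ j / factC j) = expt (Cmod z) j.
Proof.
  rewrite Cmod_div by apply factC_neq0. rewrite Cmod_pow, Cmod_factC. reflexivity.
Qed.

Lemma is_series_Cexp (z : C) :
  is_series ((fun n => z ^ n / factC n) : nat -> C_NormedModule) (Cexp z).
Proof.
  apply (ex_series_expt _ (Cmod z)). intros j. rewrite Cmod_expt. apply Rle_refl.
Qed.

Lemma mxE_series (z : C) (u : nat -> C) (l : C) :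
  is_lim_seq (fun n => Cmod (u n)) 0 ->
  is_series (tri_apply (mxE z) u : nat -> C_NormedModule) l <->
  is_series ((fun k => u k * Cexp z) : nat -> C_NormedModule) l.
Proof.
  apply (tri_apply_series (fun _ j => z ^ j / factC j) (fun _ => Cexp z) u (Cmod z)).
  - apply Cmod_ge_0.
  - intros _ j. rewrite Cmod_expt. apply Rle_refl.
  - intros _. apply is_series_Cexp.
Qed.

Lemma mxE_null (z : C) (u : nat -> C) :
  is_lim_seq (fun n => Cmod (u n)) 0 ->
  is_lim_seq (fun n => Cmod (tri_apply (mxE z) u n)) 0.
Proof.
  apply (tri_apply_null _ _ (Cmod z)); [apply Cmod_ge_0|].
  intros n k j _. unfold mxE. rewrite Cmod_expt. apply Rle_refl.
Qed.

(* [mxE z] maps the exponential series of [- z], a null sequence, to the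
   sequence [1, 0, 0, ...]; summing both gives exp(-z) exp(z) = 1. *)
Lemma Cexp_neq0 (z : C) : Cexp z <> 0.
Proof.
  intros Hz.
  set (d := fun n : nat => delta0 n).
  set (u := tri_apply (mxE (- z)) d).
  assert (Hd : is_series (d : nat -> C_NormedModule) (RtoC 1)).
  { apply is_series_clim. apply (is_lim_seq_ext (fun _ => 0%R)).
    - intros n. symmetry. transitivity (Cmod 0); [f_equal | apply Cmod_0].
      assert (Hn : sum_n d n = 1 :> C).
      { induction n as [|n IH].
        - rewrite sum_O. reflexivity.
        - rewrite csum_S, IH. unfold d, delta0. simpl. cring. }
      rewrite Hn. cring.
    - apply is_lim_seq_const. }
  assert (Hu : is_lim_seq (fun n => Cmod (u n)) 0).
  { apply mxE_null, (is_series_null _ _ Hd). }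
  assert (H1 : is_series (tri_apply (mxE z) u : nat -> C_NormedModule) (RtoC 1)).
  { apply (is_series_ext d); [|exact Hd]. intros n. symmetry. apply mxE_opp. }
  apply (mxE_series z u _ Hu), CSeries_unique in H1.
  assert (H0 : CSeries (fun k => u k * Cexp z) = 0).
  { apply CSeries_unique. apply is_series_clim.
    apply (is_lim_seq_ext (fun _ => 0%R)); [|apply is_lim_seq_const].
    intros n. symmetry. transitivity (Cmod 0); [f_equal | apply Cmod_0].
    rewrite csum_mult_r, Hz. cring. }
  apply C1_nz. rewrite <- H1. exact H0.
Qed.

(** * Bounds on the kernels *)

Section Kernel_bounds.

Variables (x nu : C).

(** The added 1 absorbs the shifts in the Pochhammer factors: [|m nu + j| <= M (m + j)], and
    [|- n nu + j| <= M n] for [j <= n]. *)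
Let M : R := (Cmod nu + 1)%R.

Lemma Cmod_pochhammer_natC_mul (k j : nat) :
  (Cmod (pochhammer (natC (S k) * nu) j)
   <= M ^ j * Cmod (pochhammer (natC (S k)) j))%R.
Proof.
  induction j as [|j IH]; simpl.
  - rewrite Cmod_1. lra.
  - rewrite !Cmod_mult.
    replace (M * M ^ j * (Cmod (pochhammer (natC (S k)) j) * Cmod (natC (S k) + natC j)))%R
      with ((M ^ j * Cmod (pochhammer (natC (S k)) j)) * (M * Cmod (natC (S k) + natC j)))%R
      by ring.
    apply Rmult_le_compat; try apply Cmod_ge_0; [exact IH|].
    eapply Rle_trans; [apply Cmod_triangle|].
    rewrite <- natC_add, Cmod_mult, !Cmod_natC, plus_INR.
    unfold M. generalize (Cmod_ge_0 nu) (pos_INR (S k)) (pos_INR j). nra.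
Qed.

Lemma pochhammer_natC_neq0 (k j : nat) : pochhammer (natC (S k)) j <> 0.
Proof.
  rewrite pochhammer_natC. unfold Cdiv. apply Cmult_neq_0; [apply factC_neq0|].
  intros H. apply (C1_nz). rewrite <- (Cinv_r (factC k)) by apply factC_neq0.
  rewrite H. cring.
Qed.

Lemma Cmod_Phi_coef_le (a b : C) (j : nat) (K : R) :
  pochhammer b j <> 0 ->
  (Cmod (pochhammer a j) <= K ^ j * Cmod (pochhammer b j))%R ->
  (Cmod (Phi_coef a b j) <= expt K j)%R.
Proof.
  intros Hb H. unfold Phi_coef, expt.
  assert (Hp : (0 < Cmod (pochhammer b j))%R) by (apply Cmod_gt_0; exact Hb).
  rewrite Cmod_div by (apply Cmult_neq_0; auto using factC_neq0).
  rewrite Cmod_mult, Cmod_factC.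
  assert (Hf := INR_fact_lt_0 j).
  apply Rmult_le_reg_r with (Cmod (pochhammer b j) * INR (fact j))%R.
  { apply Rmult_lt_0_compat; assumption. }
  field_simplify; lra.
Qed.

Lemma kerP_le (z : C) (k j : nat) :
  (Cmod (kerP x nu k j * z ^ j) <= expt (M * Cmod x * Cmod z) j)%R.
Proof.
  unfold kerP. rewrite !Cmod_mult, !Cmod_pow, Cmod_opp.
  replace (M * Cmod x * Cmod z)%R with ((Cmod x * Cmod z) * M)%R by ring.
  rewrite expt_mult, Rpow_mult_distr, Rmult_assoc, Rmult_comm.
  apply Rmult_le_compat_l.
  - apply Rmult_le_pos; apply pow_le, Cmod_ge_0.
  - apply Cmod_Phi_coef_le; [apply pochhammer_natC_neq0|].
    apply Cmod_pochhammer_natC_mul.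
Qed.

(** For [n > 0], [(1 + 1 / n) ^ j <= exp (j / n) <= exp 1 <= 3]. *)
Lemma pow_S_le_3_mul_pow (n j : nat) :
  (j <= n)%nat -> (INR (S n) ^ j <= 3 * INR n ^ j)%R.
Proof.
  intros Hj. destruct n as [|n].
  - replace j with 0%nat by lia. simpl. lra.
  - assert (Hn : (0 < INR (S n))%R) by (apply lt_0_INR; lia).
    replace (INR (S (S n))) with ((1 + / INR (S n)) * INR (S n))%R.
    2:{ rewrite (S_INR (S n)). field. lra. }
    rewrite Rpow_mult_distr. apply Rmult_le_compat_r; [apply pow_le; lra|].
    apply Rle_trans with (exp (/ INR (S n)) ^ j)%R.
    { apply pow_incr. split; [|apply exp_ineq1_le].
      generalize (Rinv_0_lt_compat _ Hn). lra. }
    assert (He : forall i, (exp (/ INR (S n)) ^ i = exp (INR i * / INR (S n)))%R).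
    { induction i as [|i IH].
      - simpl. rewrite Rmult_0_l, exp_0. reflexivity.
      - rewrite (S_INR i), Rmult_plus_distr_r, Rmult_1_l, exp_plus, <- IH. simpl. ring. }
    rewrite He. apply Rle_trans with (exp 1); [|apply exp_le_3].
    apply le_INR in Hj.
    destruct (Rle_lt_or_eq_dec (INR j * / INR (S n)) 1) as [H|H].
    + apply Rmult_le_reg_r with (INR (S n)); [exact Hn|].
      rewrite Rmult_assoc, Rinv_l; lra.
    + left. apply exp_increasing, H.
    + rewrite H. apply Rle_refl.
Qed.

(* This is [j ^ j <= e ^ j * j!] in disguise. *)
Lemma pow_le_pochhammer_opp (n j : nat) :
  (j <= n)%nat -> (INR n ^ j <= 3 ^ j * Cmod (pochhammer (- natC n) j))%R.
Proof.
  revert n. induction j as [|j IH]; intros n Hj.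
  - simpl. rewrite Cmod_1. lra.
  - destruct n as [|n]; [lia|].
    rewrite pochhammer_S_l, Cmod_mult, Cmod_opp, Cmod_natC.
    replace (- natC (S n) + 1) with (- natC n) by (rewrite natC_S; cring).
    simpl pow.
    (* One factor 3 pays for lowering the base from [n + 1] to [n], where the induction hypothesis
       applies. *)
    apply Rle_trans with (INR (S n) * (3 * (3 ^ j * Cmod (pochhammer (- natC n) j))))%R.
    + apply Rmult_le_compat_l; [apply pos_INR|].
      eapply Rle_trans; [apply pow_S_le_3_mul_pow; lia|].
      apply Rmult_le_compat_l; [lra | apply IH; lia].
    + right. ring.
Qed.

Lemma Cmod_pochhammer_opp_mul (n j : nat) :
  (j <= n)%nat -> (Cmod (pochhammer (- natC n * nu) j) <= M ^ j * INR n ^ j)%R.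
Proof.
  intros Hj. induction j as [|j IH]; simpl.
  - rewrite Cmod_1. lra.
  - rewrite Cmod_mult.
    replace (M * M ^ j * (INR n * INR n ^ j))%R
      with ((M ^ j * INR n ^ j) * (M * INR n))%R by ring.
    apply Rmult_le_compat; try apply Cmod_ge_0; [apply IH; lia|].
    eapply Rle_trans; [apply Cmod_triangle|].
    rewrite Cmod_mult, Cmod_opp, !Cmod_natC.
    assert (INR j <= INR n)%R by (apply le_INR; lia).
    unfold M. generalize (Cmod_ge_0 nu) (pos_INR n) (pos_INR j). nra.
Qed.

Lemma pochhammer_opp_natC_neq0 (n j : nat) :
  (j <= n)%nat -> pochhammer (- natC n) j <> 0.
Proof.
  intros Hj H. assert (Hp := pow_le_pochhammer_opp n j Hj).
  rewrite H, Cmod_0, Rmult_0_r in Hp.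
  destruct n as [|n].
  - replace j with 0%nat in H by lia. exact (C1_nz H).
  - assert (0 < INR (S n) ^ j)%R by (apply pow_lt, lt_0_INR; lia). lra.
Qed.

(** The denominator [(-n)_j] may be smaller than [n ^ j], but by no more than [3 ^ j], whence the 3
    in the radius. *)
Lemma kerQ_le (z : C) (n j : nat) :
  (j <= n)%nat ->
  (Cmod (kerQ x nu n j * z ^ j) <= expt (M * 3 * Cmod x * Cmod z) j)%R.
Proof.
  intros Hj. unfold kerQ. rewrite !Cmod_mult, !Cmod_pow.
  replace (M * 3 * Cmod x * Cmod z)%R with ((Cmod x * Cmod z) * (M * 3))%R by ring.
  rewrite expt_mult, Rpow_mult_distr, Rmult_assoc, Rmult_comm.
  apply Rmult_le_compat_l.
  - apply Rmult_le_pos; apply pow_le, Cmod_ge_0.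
  - apply Cmod_Phi_coef_le; [apply pochhammer_opp_natC_neq0; lia|].
    eapply Rle_trans; [apply Cmod_pochhammer_opp_mul; lia|].
    rewrite Rpow_mult_distr, Rmult_assoc.
    apply Rmult_le_compat_l; [|apply pow_le_pochhammer_opp; lia].
    apply pow_le. unfold M. generalize (Cmod_ge_0 nu). lra.
Qed.

Lemma INR_le_pow2 (j : nat) : (INR j <= 2 ^ j)%R.
Proof.
  induction j as [|j IH].
  - simpl. lra.
  - rewrite S_INR. simpl. assert (1 <= 2 ^ j)%R by (apply pow_R1_Rle; lra). lra.
Qed.

(** The ratio is a product of factors [((k + 1) nu + i) / (k + 1 + i)], each tending to [nu] as [k]
    grows. The error is of order [1 / (k + 1)], with a constant geometric in [j] and hence summable
    against [1 / j!]. *)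
Lemma pochhammer_ratio_limit (k j : nat) :
  (Cmod (pochhammer (natC (S k) * nu) j / pochhammer (natC (S k)) j - nu ^ j)
   <= (2 * M) ^ j * / INR (S k))%R.
Proof.
  assert (HM : (Cmod nu <= M /\ 1 <= M)%R)
    by (unfold M; generalize (Cmod_ge_0 nu); lra).
  assert (Hk : (0 < / INR (S k))%R) by (apply Rinv_0_lt_compat, lt_0_INR; lia).
  induction j as [|j IH].
  - change (Cmod (1 / 1 - 1) <= 1 * / INR (S k))%R.
    replace (1 / 1 - 1) with (RtoC 0) by cfield. rewrite Cmod_0. lra.
  - simpl pochhammer. rewrite <- natC_add. change (S k + j)%nat with (S (k + j)).
    set (r := pochhammer (natC (S k) * nu) j / pochhammer (natC (S k)) j) in *.
    (* The new factor equals [nu + j (1 - nu) / (k + 1 + j)]. *)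
    replace (pochhammer (natC (S k) * nu) j * (natC (S k) * nu + natC j) /
       (pochhammer (natC (S k)) j * natC (S (k + j))) - nu ^ S j)
      with ((r - nu ^ j) * nu + r * (natC j * (1 - nu) / natC (S (k + j)))).
    2:{ unfold r. change (S (k + j)) with (S k + j)%nat. rewrite Cpow_S, natC_add.
        cfield. split; [|apply pochhammer_natC_neq0].
        rewrite <- natC_add. apply natC_S_neq0. }
    eapply Rle_trans; [apply Cmod_triangle|]. rewrite !Cmod_mult.
    assert (Hr : (Cmod r <= M ^ j)%R).
    { unfold r. assert (Hp := pochhammer_natC_neq0 k j).
      rewrite Cmod_div by exact Hp. apply Rle_div_l; [apply Cmod_gt_0, Hp|].
      apply Cmod_pochhammer_natC_mul. }
    assert (Hj : (Cmod (natC j * (1 - nu) / natC (S (k + j)))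
                  <= INR j * M * / INR (S k))%R).
    { rewrite Cmod_div by apply natC_S_neq0. rewrite Cmod_mult, !Cmod_natC.
      assert (H1 : (Cmod (1 - nu) <= M)%R).
      { eapply Rle_trans; [apply Cmod_triangle|].
        rewrite Cmod_opp, Cmod_1. unfold M. lra. }
      apply Rmult_le_compat.
      - apply Rmult_le_pos; [apply pos_INR | apply Cmod_ge_0].
      - left. apply Rinv_0_lt_compat, lt_0_INR. lia.
      - apply Rmult_le_compat_l; [apply pos_INR | exact H1].
      - apply Rinv_le_contravar; [apply lt_0_INR; lia | apply le_INR; lia]. }
    (* With [j <= 2 ^ j] both summands equal [2 ^ j * M ^ (j + 1) / (k + 1)], and together they give
       [(2 * M) ^ (j + 1) / (k + 1)]. *)
    apply Rle_trans with ((2 * M) ^ j * / INR (S k) * M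
                          + M ^ j * (2 ^ j * M * / INR (S k)))%R.
    + apply Rplus_le_compat; apply Rmult_le_compat; try apply Cmod_ge_0; try lra.
      eapply Rle_trans; [exact Hj|].
      apply Rmult_le_compat_r; [lra|]. apply Rmult_le_compat_r; [lra|].
      apply INR_le_pow2.
    + right. simpl. rewrite Rpow_mult_distr. ring.
Qed.

Definition PhiP (z : C) (k : nat) : C := Phi (natC (S k) * nu) (natC (S k)) (- x * z).

Lemma is_series_PhiP (z : C) (k : nat) :
  is_series ((fun j => kerP x nu k j * z ^ j) : nat -> C_NormedModule) (PhiP z k).
Proof.
  assert (He : forall j, kerP x nu k j * z ^ j =
    Phi_coef (natC (S k) * nu) (natC (S k)) j * (- x * z) ^ j).
  { intros j. unfold kerP. rewrite Cpow_mult_l. cring. }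
  apply (is_series_ext (fun j =>
    Phi_coef (natC (S k) * nu) (natC (S k)) j * (- x * z) ^ j)).
  { intros j. symmetry. apply He. }
  apply (ex_series_expt _ (M * Cmod x * Cmod z)). intros j. rewrite <- He.
  apply kerP_le.
Qed.

(** Termwise comparison with the series of the limit: the coefficient errors sum to at most
    [exp rho / (k + 1)]. *)
Lemma PhiP_limit (z : C) : clim (PhiP z) (Cexp (nu * (- x * z))).
Proof.
  set (rho := (2 * M * Cmod (- x * z))%R).
  assert (Hr : (0 <= rho)%R).
  { unfold rho, M. generalize (Cmod_ge_0 nu) (Cmod_ge_0 (- x * z)). intros.
    apply Rmult_le_pos; lra. }
  apply (is_lim_seq_0_le _ (fun k => / INR (S k) * exp rho)%R).
  - intros k. split; [apply Cmod_ge_0|].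
    assert (Hk : (0 < / INR (S k))%R) by (apply Rinv_0_lt_compat, lt_0_INR; lia).
    assert (Hs := is_series_plus _ _ _ _ (is_series_PhiP z k)
      (is_series_opp _ _ (is_series_Cexp (nu * (- x * z))))).
    refine (series_Cmod_le _ _ _ _ Hr (Rlt_le _ _ Hk) _ Hs).
    intros j. cbv beta.
    change (Cmod (kerP x nu k j * z ^ j - (nu * (- x * z)) ^ j / factC j)
            <= / INR (S k) * expt rho j)%R.
    replace (kerP x nu k j * z ^ j - (nu * (- x * z)) ^ j / factC j)
      with ((pochhammer (natC (S k) * nu) j / pochhammer (natC (S k)) j - nu ^ j)
            * ((- x * z) ^ j / factC j)).
    2:{ unfold kerP, Phi_coef. rewrite !Cpow_mult_l. cfield.
        split; [apply factC_neq0 | apply pochhammer_natC_neq0]. }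
    rewrite Cmod_mult, Cmod_expt. unfold rho. rewrite expt_mult.
    rewrite <- Rmult_assoc, (Rmult_comm (/ INR (S k))).
    apply Rmult_le_compat_r; [apply expt_ge_0, Cmod_ge_0|].
    apply pochhammer_ratio_limit.
  - replace (Finite 0) with (Rbar_mult 0 (exp rho)) by (simpl; f_equal; ring).
    apply is_lim_seq_scal_r.
    apply (is_lim_seq_incr_1 (fun n => / INR n)%R).
    apply (is_lim_seq_inv _ _ is_lim_seq_INR). discriminate.
Qed.

End Kernel_bounds.

(** Eventually [|v n| >= |l| / 2], so division by [v n] at most multiplies by [2 / |l|]. *)
Lemma null_of_mul_null (u v : nat -> C) (l : C) :
  l <> 0 -> clim v l -> is_lim_seq (fun n => Cmod (u n * v n)) 0 ->
  is_lim_seq (fun n => Cmod (u n)) 0.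
Proof.
  intros Hl Hv H. apply Cmod_gt_0 in Hl.
  destruct (proj1 (is_lim_seq_0_iff _ (fun n => Cmod_ge_0 _)) Hv (Cmod l / 2)%R
    ltac:(lra)) as [N HN].
  apply (is_lim_seq_le_le_loc (fun _ => 0%R) _
    (fun n => (2 / Cmod l) * Cmod (u n * v n))%R).
  - exists N. intros n Hn. split; [apply Cmod_ge_0|].
    specialize (HN n Hn). rewrite Cmod_minus_sym in HN.
    assert (Hvn : (Cmod l / 2 <= Cmod (v n))%R).
    { generalize (Cmod_triangle (l - v n) (v n)).
      replace (l - v n + v n) with l by cring. lra. }
    rewrite Cmod_mult.
    apply Rmult_le_reg_l with (Cmod l / 2)%R; [lra|].
    replace (Cmod l / 2 * (2 / Cmod l * (Cmod (u n) * Cmod (v n))))%R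
      with (Cmod (v n) * Cmod (u n))%R by (field; lra).
    apply Rmult_le_compat_r; [apply Cmod_ge_0 | exact Hvn].
  - apply is_lim_seq_const.
  - replace (Finite 0) with (Rbar_mult (2 / Cmod l)%R 0) by (simpl; f_equal; ring).
    apply is_lim_seq_scal_l, H.
Qed.

(** * Exponential generating functions *)

Section Egf_transfer.

(** The sequences [a] and [b] will carry the factor [z ^ (n + 1)], so the kernels carry [z ^ j]. The
    intermediate sequence [g] is both [P b] and [E^-1 a]. *)
Variables (x nu z : C) (a b : nat -> C).

Hypothesis Hab : forall n, a n = tri_apply (mxE z)
  (tri_apply (fun _ k j => kerP x nu k j * z ^ j) b) n.

Let g : nat -> C := tri_apply (fun _ k j => kerP x nu k j * z ^ j) b.

Hypothesis Hb : forall n,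
  b n = tri_apply (fun n _ j => kerQ x nu n j * z ^ j) g n.

Let rho_ge_0 (r : R) : (0 <= r)%R -> (0 <= (Cmod nu + 1) * r * Cmod x * Cmod z)%R.
Proof.
  intros Hr. generalize (Cmod_ge_0 nu) (Cmod_ge_0 x) (Cmod_ge_0 z). intros.
  repeat apply Rmult_le_pos; lra.
Qed.

Lemma null_b_of_null_a :
  is_lim_seq (fun n => Cmod (a n)) 0 -> is_lim_seq (fun n => Cmod (b n)) 0.
Proof.
  intros Ha.
  assert (Hg : is_lim_seq (fun n => Cmod (g n)) 0).
  { apply (is_lim_seq_ext (fun n => Cmod (tri_apply (mxE (- z)) a n))).
    - intros n. f_equal. rewrite <- (mxE_opp (- z) g n).
      apply tri_apply_ext. intros k. replace (- - z) with z by cring. apply Hab.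
    - apply mxE_null, Ha. }
  apply (is_lim_seq_ext
    (fun n => Cmod (tri_apply (fun n _ j => kerQ x nu n j * z ^ j) g n))).
  { intros n. f_equal. symmetry. apply Hb. }
  refine (tri_apply_null _ _ _ (rho_ge_0 3 _) _ Hg); [lra|].
  intros n k j Hn. apply kerQ_le. lia.
Qed.

(** Column summation is applied twice, to [a = E g] and to [g = P b]: each column of [E] sums to
    [Cexp z], and column [k] of [P] to [PhiP x nu z k]. Both [b] and [g] are null, as this
    requires. *)
Lemma is_series_egf_iff (l : C) :
  is_lim_seq (fun n => Cmod (b n)) 0 ->
  is_series (a : nat -> C_NormedModule) (Cexp z * l) <->
  is_series ((fun k => b k * PhiP x nu z k) : nat -> C_NormedModule) l.
Proof.
  intros H.
  assert (Hrho : (0 <= (Cmod nu + 1) * Cmod x * Cmod z)%R).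
  { rewrite <- (Rmult_1_r (Cmod nu + 1)). apply rho_ge_0. lra. }
  assert (Hg : is_lim_seq (fun n => Cmod (g n)) 0).
  { refine (tri_apply_null _ _ _ Hrho _ H). intros n k j _. apply kerP_le. }
  rewrite <- (tri_apply_series (fun k j => kerP x nu k j * z ^ j) _ b _ l
    Hrho (kerP_le x nu z) (is_series_PhiP x nu z) H).
  change (tri_apply (fun _ k j => kerP x nu k j * z ^ j) b) with g.
  transitivity (is_series ((fun k => g k * Cexp z) : nat -> C_NormedModule)
    (Cexp z * l)).
  - rewrite <- (mxE_series z g _ Hg). split; apply is_series_ext; intros n.
    + apply Hab.
    + symmetry. apply Hab.
  - assert (Hz := Cexp_neq0 z). split; intros Hl.
    + apply (is_series_mult_r _ _ (/ Cexp z)) in Hl.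
      replace (Cexp z * l * / Cexp z) with l in Hl by (cfield; exact Hz).
      revert Hl. apply is_series_ext. intros n. cfield. exact Hz.
    + rewrite Cmult_comm. apply is_series_mult_r, Hl.
Qed.

Lemma null_b_of_series (l : C) :
  is_series ((fun k => b k * PhiP x nu z k) : nat -> C_NormedModule) l ->
  is_lim_seq (fun n => Cmod (b n)) 0.
Proof.
  intros H.
  exact (null_of_mul_null b _ _ (Cexp_neq0 _) (PhiP_limit x nu z) (is_series_null _ _ H)).
Qed.

Lemma egf_transfer :
  (ex_series (a : nat -> C_NormedModule) <->
   ex_series ((fun k => b k * PhiP x nu z k) : nat -> C_NormedModule)) /\
  (ex_series (a : nat -> C_NormedModule) ->
   CSeries a = Cexp z * CSeries (fun k => b k * PhiP x nu z k)).
Proof.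
  assert (H : forall l : C, is_series (a : nat -> C_NormedModule) l ->
    is_series ((fun k => b k * PhiP x nu z k) : nat -> C_NormedModule) (l / Cexp z)).
  { intros l Hl.
    apply is_series_egf_iff; [exact (null_b_of_null_a (is_series_null _ _ Hl))|].
    replace (Cexp z * (l / Cexp z)) with l by (cfield; apply Cexp_neq0). exact Hl. }
  split; [split|]; intros [l Hl]; change C in (type of l).
  - exists (l / Cexp z). exact (H l Hl).
  - exists (Cexp z * l). apply is_series_egf_iff; [|exact Hl].
    exact (null_b_of_series l Hl).
  - rewrite (CSeries_unique _ _ Hl), (CSeries_unique _ _ (H l Hl)).
    cfield. apply Cexp_neq0.
Qed.

End Egf_transfer.

(** * The formal identity and the conclusion *)

Lemma fps_sum_Phi (x nu : C) (t : nat -> C) (n : nat) :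
  fps_sum (fun k => fps_scale ((-1) ^ k * t k / factC k)
    (fps_mulXn k (fps_Phi (natC k * nu) (natC k) (- x)))) (S n) =
  tri_apply (mxP x nu) (fun k => (-1) ^ S k * t (S k) / factC (S k)) n.
Proof.
  unfold fps_sum, tri_apply. rewrite csum_m_1. apply sum_n_ext_loc. intros k Hk.
  unfold fps_scale, fps_mulXn.
  replace (Nat.ltb (S n) (S k)) with false by (symmetry; apply Nat.ltb_ge; lia).
  reflexivity.
Qed.

(** The vanishing constant term of [f] removes the last summand; what remains, read backwards, is
    the shifted matrix product. *)
Lemma fps_exp_mul_S (f : fps) (n : nat) :
  f 0%nat = 0 ->
  fps_mul fps_exp f (S n) = tri_apply (mxE 1) (fun k => f (S k)) n.
Proof.
  intros Hf. unfold fps_mul, tri_apply.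
  rewrite csum_S, Nat.sub_diag, Hf, Cmult_0_r, Cplus_0_r, sum_n_rev.
  apply sum_n_ext_loc. intros k Hk. unfold fps_exp, mxE.
  replace (S n - (n - k))%nat with (S k) by lia.
  rewrite Cpow_1_l. unfold Cdiv. cring.
Qed.

Theorem corollary3p3 (x nu : C) (s t : nat -> C)
    (hst : is_image (matB x nu) t s \/ is_image (matA x nu) s t) :
  (forall z : C,
     (ex_series (fun n => egf_term s z (S n)) <->
      ex_series (fun k => Phi_term x nu t z (S k))) /\
     (ex_series (fun n => egf_term s z (S n)) ->
      egf s z = Cexp z * CSeries (fun k => Phi_term x nu t z (S k)))) /\
  (forall n : nat,
     fps_egf s n =
     fps_mul fps_exp
       (fps_sum (fun k =>
          fps_scale ((-1) ^ k * t k / factC k)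
            (fps_mulXn k (fps_Phi (natC k * nu) (natC k) (- x))))) n).
Proof.
  assert (Hst := is_image_normal x nu s t hst). cbv beta in Hst.
  set (b := fun n : nat => (-1) ^ S n * t (S n) / factC (S n)) in Hst.
  split.
  - intros z.
    set (bz := fun n => b n * z ^ S n).
    assert (Hg : forall n, tri_apply (mxP x nu) b n * z ^ S n =
      tri_apply (fun _ k j => kerP x nu k j * z ^ j) bz n).
    { intros n. apply (tri_apply_scale (mxP x nu)). }
    assert (Ha : forall n, egf_term s z (S n) =
      tri_apply (mxE z) (tri_apply (fun _ k j => kerP x nu k j * z ^ j) bz) n).
    { intros n. unfold egf_term.
      replace (s (S n) * (z ^ S n / factC (S n)))
        with (s (S n) / factC (S n) * z ^ S n) by (unfold Cdiv; cring).
      rewrite Hst, tri_apply_scale. rewrite <- (tri_apply_ext _ _ _ n Hg).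
      apply sum_n_ext. intros k. f_equal. unfold mxE. rewrite Cpow_1_l.
      unfold Cdiv. cring. }
    (* The identity [Q P = 1], conjugated by the powers of [z]. *)
    assert (Hb : forall n, bz n = tri_apply (fun n _ j => kerQ x nu n j * z ^ j)
      (tri_apply (fun _ k j => kerP x nu k j * z ^ j) bz) n).
    { intros n. rewrite <- (tri_apply_ext _ _ _ n Hg).
      rewrite <- (tri_apply_scale (mxQ x nu)), mxQ_mxP. reflexivity. }
    assert (HPhi : forall k, bz k * PhiP x nu z k = Phi_term x nu t z (S k)).
    { intros k. unfold bz, b, Phi_term, PhiP, Cdiv. cring. }
    destruct (egf_transfer x nu z _ _ Ha Hb) as [Hiff Heq].
    assert (Hfun : CSeries (fun k => bz k * PhiP x nu z k) =
                   CSeries (fun k => Phi_term x nu t z (S k))).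
    { unfold CSeries. f_equal; apply Series_ext; intros k; rewrite HPhi; reflexivity. }
    rewrite <- Hfun. split; [|exact Heq].
    rewrite Hiff. split; apply ex_series_ext; intros k.
    + apply HPhi.
    + symmetry. apply HPhi.
  - intros [|n].
    (* At order 0 the sum over [k] from 1 to 0 is empty, so both sides vanish. *)
    + unfold fps_egf, fps_mul, fps_sum. simpl. rewrite sum_O, sum_n_m_zero by lia.
      change (RtoC 0 = fps_exp 0%nat * 0). cring.
    + rewrite fps_exp_mul_S.
      * rewrite (tri_apply_ext _ _ _ n (fps_sum_Phi x nu t)).
        unfold fps_egf. simpl Nat.eqb. cbv iota. apply Hst.
      * unfold fps_sum. rewrite sum_n_m_zero by lia. reflexivity.
Qed.
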